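(* Let $\mathcal C$ be a category with finite products and assume there exists a function $\lambda \colon \mathrm{Ob}(\mathcal C) \to \mathbb N$ such that, for all $A, B \in \mathrm{Ob}(\mathcal C)$, the following hold: (1) $\lambda(A) = 0$ if and only if $A$ is a terminal object of $\mathcal C$; (2) $\lambda(A) + \lambda(B) \le \lambda(P)$ for every object $P \in \mathrm{Ob}(\mathcal C)$ that is a (categorical) product of $A$ by $B$. Then every $X \in \mathrm{Ob}(\mathcal C)$ is isomorphic to a finite product of directly irreducible objects, i.e., of non-terminal objects of $\mathcal C$ each of which is not isomorphic to a product of two non-terminal objects.
   Context: $\mathrm{Ob}(\mathcal C)$ is the class of objects of $\mathcal C$; all objects and morphisms of the categories considered belong to a fixed Grothendieck universe (Tarski–Grothendieck set theory is the foundation). $\mathbb N$ is the set of non-negative integers. A category with finite products is one in which every finite-indexed family of objects has a product; equivalently, it has a terminal object and every pair of objects has a product. Products are understood up to the usual universal property, so ''product of $A$ by $B$'' means any object which, together with suitable projections to $A$ and $B$, satisfies that property. An empty product is a terminal object, and the finite product in the conclusion may be empty. *)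

(* Defs.v *)
From mathcomp Require Import all_boot.

Set Implicit Arguments.
Unset Strict Implicit.
Unset Printing Implicit Defensive.

(* Objects and morphisms range over unrelated universe levels, so no local
   smallness is imposed. *)
Record category := Category {
  Ob :> Type;
  hom : Ob -> Ob -> Type;
  idm : forall A : Ob, hom A A;
  compm : forall A B D : Ob, hom B D -> hom A B -> hom A D;
  compm_idl : forall (A B : Ob) (f : hom A B), compm (idm B) f = f;
  compm_idr : forall (A B : Ob) (f : hom A B), compm f (idm A) = f;
  compm_assoc : forall (A B D E : Ob)
      (h : hom D E) (g : hom B D) (f : hom A B),
    compm h (compm g f) = compm (compm h g) f
}.

Arguments idm {c} A.
Arguments compm {c A B D} g f.

Definition isomorphic (C : category) (A B : C) : Prop :=
  exists (f : hom A B) (g : hom B A), compm g f = idm A /\ compm f g = idm B.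

Definition terminal (C : category) (T : C) : Prop :=
  forall A : C, exists! f : hom A T, True.

Definition is_product (C : category) (I : Type) (F : I -> C) (P : C)
    (pi : forall i : I, hom P (F i)) : Prop :=
  forall (Q : C) (q : forall i : I, hom Q (F i)),
    exists! h : hom Q P, forall i : I, compm (pi i) h = q i.

Definition product_of (C : category) (I : Type) (F : I -> C) (P : C) : Prop :=
  exists pi : forall i : I, hom P (F i), is_product pi.

Definition is_binary_product (C : category) (A B P : C)
    (p : hom P A) (q : hom P B) : Prop :=
  forall (Q : C) (f : hom Q A) (g : hom Q B),
    exists! h : hom Q P, compm p h = f /\ compm q h = g.

Definition binary_product_of (C : category) (A B P : C) : Prop :=
  exists (p : hom P A) (q : hom P B), is_binary_product p q.

Definition has_finite_products (C : category) : Prop :=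
  forall (n : nat) (F : 'I_n -> C), exists P : C, product_of F P.

Definition directly_irreducible (C : category) (A : C) : Prop :=
  ~ terminal A /\
  ~ (exists B D P : C, [/\ ~ terminal B, ~ terminal D,
       binary_product_of B D P & isomorphic A P]).

(* Main.v *)
Require Import Defs.
From Stdlib Require Import Classical.
From mathcomp Require Import all_boot.

(** The measure [lambda] turns the obvious splitting procedure into one that
    stops.  Either [X] is terminal, and is then the empty product; or it is
    directly irreducible, and is then the product of the family reduced to
    itself; or it is a binary product of two non-terminal objects [B] and [D].
    In the last case [lambda B] and [lambda D] are positive with sum at most
    [lambda X], so both are smaller than [lambda X] and, by strong induction,
    [B] and [D] are finite products of directly irreducible objects.  Putting
    the two families side by side decomposes [X] ([product_of_split]).

    Because being a product is a universal property, it is invariant under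
    isomorphism ([binary_product_of_iso]); hence [X] itself, rather than
    some isomorphic copy, can be kept as the product throughout. *)

Set Implicit Arguments.
Unset Strict Implicit.
Unset Printing Implicit Defensive.

Lemma binary_product_of_iso (C : category) (A B P X : C) :
  isomorphic X P -> binary_product_of A B P -> binary_product_of A B X.
Proof.
move=> [u [v [vu uv]]] [p [q prodP]].
exists (compm p u), (compm q u) => Q f g.
have [h [[hf hg] h_uniq]] := prodP Q f g.
exists (compm v h); split.
  by rewrite !compm_assoc -!(compm_assoc _ u v) uv !compm_idr.
move=> k [kf kg]; rewrite (h_uniq (compm u k)).
  by rewrite compm_assoc vu compm_idl.
by rewrite !compm_assoc.
Qed.

Lemma product_of_empty (C : category) (F : 'I_0 -> C) (T : C) :
  terminal T -> product_of F T.
Proof.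
move=> termT.
have pi (i : 'I_0) : hom T (F i) by case: i.
exists pi => Q q; have [h [_ h_uniq]] := termT Q.
by exists h; split=> [[]//|k _]; apply: h_uniq.
Qed.

Lemma product_of_single (C : category) (A : C) :
  product_of (fun _ : 'I_1 => A) A.
Proof.
exists (fun=> idm A) => Q q; exists (q ord0); split.
  by move=> i; rewrite compm_idl ord1.
by move=> k /(_ ord0); rewrite compm_idl.
Qed.

Lemma product_of_sum (C : category) (I J : Type) (F : I -> C) (G : J -> C)
    (A B P : C) :
  product_of F A -> product_of G B -> binary_product_of A B P ->
  product_of (fun k : I + J => match k with inl i => F i | inr j => G j end) P.
Proof.
move=> [pF prodF] [pG prodG] [p [q prodP]].
exists (fun k => match k return
          hom P (match k with inl i => F i | inr j => G j end) with
        | inl i => compm (pF i) p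
        | inr j => compm (pG j) q
        end) => Q r.
have [f [fE f_uniq]] := prodF Q (fun i => r (inl i)).
have [g [gE g_uniq]] := prodG Q (fun j => r (inr j)).
have [h [[hf hg] h_uniq]] := prodP Q f g.
exists h; split=> [[i|j]|k kE].
- by rewrite -compm_assoc hf fE.
- by rewrite -compm_assoc hg gE.
- apply: h_uniq; split; symmetry.
    by apply: f_uniq => i; rewrite compm_assoc (kE (inl i)).
  by apply: g_uniq => j; rewrite compm_assoc (kE (inr j)).
Qed.

(** Transporting [q (f i)] along [g (f i) = i], for [f] an inverse of [g],
    gives the extension; decidable equality on [I] makes the choice of
    equality proof immaterial, so that the transport cancels at [g j]. *)
Lemma dependent_family_reindex (I : eqType) (J : Type) (g : J -> I)
    (T : I -> Type) (q : forall j, T (g j)) :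
  bijective g -> exists q' : forall i, T i, forall j, q' (g j) = q j.
Proof.
move=> [f gK fK].
exists (fun i => ecast i (T i) (fK i) (q (f i))) => j.
rewrite (eq_irrelevance (fK (g j)) (congr1 g (gK j))).
move: (gK j); move: (f (g j)) => x e.
by destruct e.
Qed.

Lemma product_of_reindex (C : category) (I : eqType) (J : Type) (g : J -> I)
    (F : I -> C) (P : C) :
  bijective g -> product_of F P -> product_of (fun j => F (g j)) P.
Proof.
move=> g_bij [pi prodP]; exists (fun j => pi (g j)) => Q q.
have [q' q'E] := @dependent_family_reindex _ _ _ (fun i => hom Q (F i)) q g_bij.
have [h [hE h_uniq]] := prodP Q q'.
exists h; split=> [j|k kE]; first by rewrite hE q'E.
apply: h_uniq => i; case: g_bij => f _ fK.
by rewrite -[i]fK kE q'E.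
Qed.

Lemma product_of_split (C : category) (m n : nat) (F : 'I_m -> C)
    (G : 'I_n -> C) (A B P : C) :
  product_of F A -> product_of G B -> binary_product_of A B P ->
  product_of (fun k : 'I_(m + n) =>
    match split k with inl i => F i | inr j => G j end) P.
Proof.
move=> prodF prodG prodP.
apply: (product_of_reindex _ (product_of_sum prodF prodG prodP)).
by exists (@unsplit m n); [apply: splitK | apply: unsplitK].
Qed.

Lemma isomorphic_refl (C : category) (A : C) : isomorphic A A.
Proof. by exists (idm A), (idm A); rewrite compm_idl. Qed.

Theorem corollary4p13 (C : category) (C_prod : has_finite_products C)
    (lambda : C -> nat)
    (lambda_eq0 : forall A : C, lambda A = 0 <-> terminal A)
    (lambda_prod : forall A B P : C, binary_product_of A B P ->
       lambda A + lambda B <= lambda P)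
    (X : C) :
  exists (n : nat) (F : 'I_n -> C) (P : C),
    [/\ forall i : 'I_n, directly_irreducible (F i),
        product_of F P & isomorphic X P].
Proof.
suff [n [F [irrF prodF]]] : exists (n : nat) (F : 'I_n -> C),
    (forall i, directly_irreducible (F i)) /\ product_of F X.
  by exists n, F, X; split=> //; apply: isomorphic_refl.
have lambda_gt0 A : ~ terminal A -> 0 < lambda A.
  by move=> ntA; rewrite lt0n; apply/eqP => /lambda_eq0.
have [N] := ubnP (lambda X); elim: N X => // N IHN X ltXN.
have [termX|ntX] := classic (terminal X).
  by exists 0, (fun=> X); split=> [[]//|]; apply: product_of_empty.
have [irrX|redX] := classic (directly_irreducible X).
  by exists 1, (fun=> X); split=> //; apply: product_of_single.
have [B [D [P [ntB ntD prodP isoXP]]]] : exists B D P : C,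
    [/\ ~ terminal B, ~ terminal D, binary_product_of B D P & isomorphic X P].
  by apply: NNPP => no_split; apply: redX.
have prodX := binary_product_of_iso isoXP prodP.
have leX : lambda B + lambda D <= N := leq_trans (lambda_prod _ _ _ prodX) ltXN.
have [|m [F [irrF prodF]]] := IHN B.
  by apply: leq_trans leX; rewrite -addn1 leq_add2l lambda_gt0.
have [|n [G [irrG prodG]]] := IHN D.
  by apply: leq_trans leX; rewrite -add1n leq_add2r lambda_gt0.
exists (m + n), (fun k => match split k with inl i => F i | inr j => G j end).
split; last exact: product_of_split prodF prodG prodX.
by move=> k; case: (split k).
Qed.
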